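(* Let $F=\{A_F;f_1,\dots,f_N\}$ and $G=\{A_G;g_1,\dots,g_N\}$ be IFSs with the same number $N$ of functions, with attractors $A_F$ and $A_G$. Assume that both $A_F$ and $A_G$ are non-overlapping (w.r.t. $F$ and $G$ respectively), and let $\mu_F$ and $\mu_G$ be the invariant measures of $F$ and $G$ associated with the same probability vector $p=(p_1,\dots,p_N)$. Let $T_{FG}:A_F\to A_G$ and $T_{GF}:A_G\to A_F$ be the fractal transformations. Then (1) $T_{FG}:A_F\to A_G$ is measurable and is continuous almost everywhere with respect to $\mu_F$; (2) $\mu_F\circ T_{GF}=\mu_G$ and $\mu_G\circ T_{FG}=\mu_F$; that is, $\mu_F(T_{GF}(B))=\mu_G(B)$ for every Borel set $B\subset A_G$, and $\mu_G(T_{FG}(B))=\mu_F(B)$ for every Borel set $B\subset A_F$.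
   Context: IFS: An IFS $F=\{A;f_1,\dots,f_N\}$ with attractor $A$ consists of a nonempty compact metric space $A$ and maps $f_i:A\to A$, $i\in I=\{1,\dots,N\}$, each of which is a homeomorphism onto its image, which are contractions (there is $\lambda\in[0,1)$ with $d(f_i(x),f_i(y))\le\lambda d(x,y)$ for all $x,y\in A$ and all $i\in I$), and such that $A=\bigcup_{i=1}^N f_i(A)$. For $U\subset A$ put $F^{-1}(U)=\bigcup_{i=1}^N f_i^{-1}(U)$, where $f_i^{-1}(U)=\{x\in A: f_i(x)\in U\}$, and let $F^{-k}$ be the $k$-fold composition of $F^{-1}$. The critical set is $C=\bigcup_{i\ne j} f_i(A)\cap f_j(A)$. The dynamical boundary is $\partial A=\overline{\bigcup_{k=1}^\infty F^{-k}(C)}$ (closure in $A$). $A$ is non-overlapping (w.r.t. $F$) when $A\neq\partial A$. Code space: $I^\infty$ is the set of infinite sequences $\theta=\theta_1\theta_2\cdots$ over $I$, with metric $d(\theta,\sigma)=2^{-k}$ where $k$ is the least index with $\theta_k\neq\sigma_k$. The coding map $\pi_F:I^\infty\to A$ is $\pi_F(\sigma)=\lim_{k\to\infty}f_{\sigma_1}\circ\cdots\circ f_{\sigma_k}(a)$, independent of $a\in A$; it is continuous and onto. $I^\infty$ is ordered lexicographically, with the convention $1>2>\cdots>N$: $\theta>\sigma$ iff $\theta\ne\sigma$ and $\theta_k>\sigma_k$ in this order of symbols at the least index $k$ where they differ. The top section $\tau_F:A\to I^\infty$ is $\tau_F(x)=\max\pi_F^{-1}(x)$ (lexicographic maximum).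 Fractal transformations: $T_{FG}=\pi_G\circ\tau_F$ and $T_{GF}=\pi_F\circ\tau_G$. Invariant measure: a probability vector is $p=(p_1,\dots,p_N)$ with all $p_i>0$ and $\sum p_i=1$. The invariant measure of $F$ associated with $p$ is the unique Borel probability measure $\mu_F$ on $A$ with $\mu_F(B)=\sum_{i=1}^N p_i\,\mu_F(f_i^{-1}(B))$ for all Borel $B\subset A$. Measures of images such as $\mu_F(T_{GF}(B))$ are understood with respect to the completion of the measure. ''Continuous almost everywhere w.r.t. $\mu_F$'' means: continuous at every point outside a set of $\mu_F$-measure $0$. *)

(* Defs.v *)
From HB Require Import structures.
From mathcomp Require Import all_boot all_order all_algebra.
From mathcomp Require Import all_classical all_reals all_analysis.
From mathcomp Require Import measurable_realfun.

Set Implicit Arguments.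
Unset Strict Implicit.
Unset Printing Implicit Defensive.

Import Order.TTheory GRing.Theory Num.Theory.
Import numFieldNormedType.Exports.

Local Open Scope classical_set_scope.
Local Open Scope ring_scope.

(* Nonempty metric spaces. The base point [point] witnesses nonemptiness, as
   required by [measurableType] and [lim]; an IFS structure does not refer to
   it. *)
#[short(type="pmetricType")]
HB.structure Definition PointedMetric (K : numDomainType) :=
  {M of Pointed M & Metric K M}.

Notation borel A := (g_sigma_algebraType (@open A)).

Section ifs.
Context {R : realType} {A : pmetricType R} {N : nat}.

(* The index set {1, ..., N} of the maps is represented by 'I_N.+1, that is
   {0, ..., N}: covering a nonempty space takes at least one map. *)
Implicit Type f : 'I_N.+1 -> A -> A.

Definition homeomorphism_onto_image (h : A -> A) : Prop :=
  continuous h /\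
  exists2 g : A -> A, cancel h g & {within range h, continuous g}.

Record is_ifs f : Prop := IsIFS {
  ifs_compact : compact [set: A] ;
  ifs_homeomorphism : forall i, homeomorphism_onto_image (f i) ;
  ifs_contraction : exists2 l : R, 0 <= l < 1 &
    forall i (x y : A), mdist (f i x) (f i y) <= l * mdist x y ;
  ifs_attractor : [set: A] = \bigcup_i range (f i) }.

Definition ifs_preimage f (U : set A) : set A := \bigcup_i (f i @^-1` U).

Definition critical_set f : set A :=
  \bigcup_i \bigcup_(j in [set j | j != i]) (range (f i) `&` range (f j)).

Definition dynamical_boundary f : set A :=
  closure (\bigcup_(k in [set k | (1 <= k)%N])
             iter k (ifs_preimage f) (critical_set f)).

Definition non_overlapping f : Prop := [set: A] <> dynamical_boundary f.

(* f_(s 0) (f_(s 1) (... (f_(s k.-1) a))) *)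
Definition coding_approx f (s : nat -> 'I_N.+1) (k : nat) (a : A) : A :=
  foldr f a (mkseq s k).

(* For an IFS the limit exists and is the same from every starting point. *)
Definition coding_map f (s : nat -> 'I_N.+1) : A :=
  lim (coding_approx f s k point @[k --> \oo]).

End ifs.

(* Symbols are ordered by 1 > 2 > ... > N, so the greater sequence is the one
   with the smaller index at the first difference. *)
Definition lex_gt {N : nat} (s t : nat -> 'I_N.+1) : Prop :=
  exists k, (forall j, (j < k)%N -> s j = t j) /\ (s k < t k)%N.

Definition is_lex_max {N : nat} (S : set (nat -> 'I_N.+1))
    (s : nat -> 'I_N.+1) : Prop :=
  S s /\ forall t, S t -> t <> s -> lex_gt s t.

(* The default sequence is returned only if there is no maximum, which does not
   happen for an IFS. *)
Definition top_section {R : realType} {A : pmetricType R} {N : nat}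
    (f : 'I_N.+1 -> A -> A) (x : A) : nat -> 'I_N.+1 :=
  xget (fun=> ord0) [set s | is_lex_max (coding_map f @^-1` [set x]) s].

Definition fractal_transformation {R : realType} {A B : pmetricType R}
    {N : nat} (f : 'I_N.+1 -> A -> A) (g : 'I_N.+1 -> B -> B) : A -> B :=
  coding_map g \o top_section f.

Definition probability_vector {R : realType} {N : nat}
    (p : 'I_N.+1 -> R) : Prop :=
  (forall i, 0 < p i) /\ \sum_i p i = 1.

(* For an IFS and a probability vector exactly one Borel probability measure
   satisfies this equation. *)
Definition is_invariant_measure {R : realType} {A : pmetricType R} {N : nat}
    (f : 'I_N.+1 -> A -> A) (p : 'I_N.+1 -> R)
    (mu : probability (borel A) R) : Prop :=
  forall B : set (borel A), measurable B ->
    mu B = (\sum_i (p i)%:E * mu (f i @^-1` B))%E.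

(* Value of the completion of mu at a set of [completed_algebra_gen mu], the
   sigma-algebra of the sets A `|` N with A measurable and N negligible; see
   [completionE]. It has no meaning on other sets. *)
Definition completion {d : measure_display} {T : measurableType d}
    {R : realType} (mu : {measure set T -> \bar R}) (S : set T) : \bar R :=
  mu (xget set0
       [set A | measurable A /\ exists2 N, mu.-negligible N & A `|` N = S]).

Lemma completionE {d : measure_display} {T : measurableType d} {R : realType}
    (mu : {measure set T -> \bar R}) (A N : set T) :
  measurable A -> mu.-negligible N -> completion mu (A `|` N) = mu A.
Proof.
move=> mA nN; rewrite /completion; case: xgetP => [B _ [mB [M nM BM]]|]; last first.
  by move=> /(_ A) []; split => //; exists N.
have le (C D E L : set T) : measurable C -> measurable D ->
    mu.-negligible L -> C `|` E = D `|` L -> (mu C <= mu D)%E.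
  move=> mC mD [K [mK K0 LK]] CE.
  apply: (@le_trans _ _ (mu (D `|` K))).
    apply: le_measure; rewrite ?inE//; first exact: measurableU.
    move=> x Cx; have : (D `|` L) x by rewrite -CE; left.
    by move=> [|/LK]; [left|right].
  by apply: (le_trans (measureU2 mu mD mK)); rewrite [X in (_ + X)%E]K0 adde0.
by apply/eqP; rewrite eq_le; apply/andP; split;
  [exact: (le _ _ M N)|exact: (le _ _ N M)].
Qed.

(* Main.v *)
(** The top section of F is the itinerary of the shift map S, where S inverts
    f_i on the points whose least index with x in f_i(A) is i.  The dynamical
    boundary D is closed and backward invariant, so the invariant measure gives
    every preimage of D under a composition of the f_i the same mass as D; as
    the complement of D contains some f_w(A), that mass is 0.  Hence the
    critical set and its preimages under the f_i are null, S preserves the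
    measure, and almost every point is regular: its S-orbit avoids the critical
    set.  A regular point has a single address, and T_FG is continuous there.  Since
    T_FG o f_i = g_i o T_FG almost everywhere, the image of mu_F by T_FG is
    invariant for G and is therefore mu_G.  Finally T_GF o T_FG is the identity
    where T_FG is regular, so that T_GF(B) and the preimage of B by T_FG differ
    by a null set. *)

Require Import Defs.
From mathcomp Require Import all_boot all_order all_algebra.
From mathcomp Require Import all_classical all_reals all_analysis.
From mathcomp Require Import measurable_realfun.

Set Implicit Arguments.
Unset Strict Implicit.
Unset Printing Implicit Defensive.

Import Order.TTheory GRing.Theory Num.Theory.
Import numFieldNormedType.Exports.

Local Open Scope classical_set_scope.
Local Open Scope ring_scope.

(** * Contraction estimates and convergence of the coding map *)

Lemma mkseq_cons (T : Type) (t : nat -> T) k :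
  mkseq t k.+1 = t 0%N :: mkseq (t \o succn) k.
Proof. by rewrite /mkseq /= (iotaDl 1 0 k) -map_comp. Qed.

(* Bounds the diameters of the images under compositions of k maps; pulling the
   r k-neighbourhoods back through one map at a time avoids sums over words. *)
Record contraction_scale {R : realType} {A : pmetricType R} {N : nat}
    (f : 'I_N.+1 -> A -> A) (r : nat -> R) : Prop := ContractionScale {
  scale_cvg0 : r k @[k --> \oo] --> (0 : R) ;
  scale_diam : forall x y : A, mdist x y < r 0%N ;
  scale_contract : forall i k (x y : A),
    mdist x y < r k -> mdist (f i x) (f i y) < r k.+1 }.

Section coding.
Context {R : realType} {A : pmetricType R} {N : nat} (f : 'I_N.+1 -> A -> A).
Hypothesis ifs_f : is_ifs f.
Implicit Types (x y : A) (i j : 'I_N.+1) (s t : nat -> 'I_N.+1).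

(** Compactness in its near-covering form: on the unit ball around [x], every large enough integer
    bounds the distance to [point]. *)
Lemma mdist_bounded : exists M : R, forall x y, mdist x y < M.
Proof.
have [n _ nP] : \forall n \near \oo,
    [set: A] `<=` [set x | mdist (point : A) x < n%:R].
  have := ifs_compact ifs_f; rewrite compact_near_coveringP; apply=> x _.
  exists (ball x 1, [set m | (Num.truncn (mdist point x + 1) < m)%N]).
    by split; [exact: nbhsx_ballx|exists (Num.truncn (mdist point x + 1)).+1].
  move=> [y m] /= [+ nm]; rewrite ballEmdist /= => xy.
  apply: (le_lt_trans (metric_triangle _ x _)).
  apply: (@lt_trans _ _ (mdist point x + 1)); first by rewrite ltrD2l.
  by apply: (lt_le_trans (Num.Theory.truncnS_gt _)); rewrite ler_nat.
have {}nP x : mdist point x < n%:R :> R by have := nP n (leqnn n) x I.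
exists (n%:R + n%:R) => x y; apply: (le_lt_trans (metric_triangle _ point _)).
by rewrite ltrD// metric_sym.
Qed.

Lemma ifs_scale : exists r : nat -> R, contraction_scale f r.
Proof.
have [M MP] := mdist_bounded.
have [l /andP[l0 l1] lP] := ifs_contraction ifs_f.
have M0 : 0 < M by exact: le_lt_trans (mdist_ge0 _ _) (MP point point).
(* Since [l] may be 0, the midpoint [q] of [l] and 1 replaces it: it is positive, so multiplying by
   it preserves strict bounds. *)
pose q := (l + 1) / 2.
have q0 : 0 < q by rewrite divr_gt0// ltr_wpDl.
have q1 : q < 1 by rewrite ltr_pdivrMr// mul1r ltrD2r.
have lq : l <= q by rewrite ler_pdivlMr// mulr_natr mulr2n lerD2l ltW.
exists (fun k => q ^+ k * M); split.
- rewrite -[X in _ --> X](mul0r M); apply: cvgMl.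
  by apply: cvg_expr; rewrite gtr0_norm.
- by move=> x y; rewrite expr0 mul1r.
- move=> i k x y xy; apply: (le_lt_trans (lP _ _ _)).
  rewrite exprS -mulrA; apply: (@le_lt_trans _ _ (q * mdist x y)).
    by rewrite ler_wpM2r// mdist_ge0.
  by rewrite ltr_pM2l.
Qed.

Lemma ifs_continuous i : continuous (f i).
Proof. by have [] := ifs_homeomorphism ifs_f i. Qed.

Lemma ifs_injective i : injective (f i).
Proof.
by have [_ [g gK _]] := ifs_homeomorphism ifs_f i; exact: can_inj gK.
Qed.

Lemma ifs_range_closed i : closed (range (f i)).
Proof.
apply: compact_closed; first exact: metric_hausdorff.
apply: continuous_compact (ifs_compact ifs_f).
exact/continuous_subspaceT/ifs_continuous.
Qed.

Lemma ifs_image_closed i (K : set A) : closed K -> closed (f i @` K).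
Proof.
move=> cK; apply: compact_closed; first exact: metric_hausdorff.
apply: continuous_compact; first exact/continuous_subspaceT/ifs_continuous.
exact: subclosed_compact cK (ifs_compact ifs_f) _.
Qed.

Section coding_scale.
Variable r : nat -> R.
Hypothesis rf : contraction_scale f r.

Lemma scale_small (e : R) : 0 < e -> exists k, r k < e.
Proof.
move=> e0; have /cvgrPdist_lt/(_ e e0)[k _ kP] := scale_cvg0 rf.
exists k; have := kP k (leqnn k); rewrite /= sub0r normrN.
exact: le_lt_trans (ler_norm _).
Qed.

Lemma mdist_foldr w x y : mdist (foldr f x w) (foldr f y w) < r (size w).
Proof.
elim: w => [|i w IHw] /=; first exact: scale_diam rf _ _.
exact: scale_contract rf _ _ _ _ IHw.
Qed.

Lemma mdist_coding_approx t k x y :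
  mdist (coding_approx f t k x) (coding_approx f t k y) < r k.
Proof. by have := mdist_foldr (mkseq t k) x y; rewrite size_mkseq. Qed.

Lemma coding_approxD t k m x :
  coding_approx f t (k + m) x =
  coding_approx f t k (coding_approx f (fun n => t (k + n)%N) m x).
Proof.
rewrite /coding_approx /mkseq iotaD map_cat foldr_cat.
by rewrite add0n -[k in iota k m]addn0 iotaDl -map_comp.
Qed.

Lemma coding_approx_cvg t x :
  (forall k, mdist (coding_approx f t k point) x < r k) -> 
  coding_approx f t k point @[k --> \oo] --> x.
Proof.
move=> tx; apply/metricType_numDomainType.cvgrPdist_lt => e e0.
have /cvgrPdist_lt/(_ e e0) := scale_cvg0 rf.
apply: filterS => k; rewrite sub0r normrN metric_sym => re.
exact: lt_le_trans (tx k) (le_trans (ler_norm _) (ltW re)).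
Qed.

Lemma coding_map_unique t x :
  (forall k, mdist (coding_approx f t k point) x < r k) -> coding_map f t = x.
Proof.
by move=> /coding_approx_cvg /cvg_lim; apply; exact: metric_hausdorff.
Qed.

End coding_scale.

(** Compactness supplies a cluster point. From index [k] on, all approximations lie in the image of
    one composition of [k] maps, of diameter at most [r k], so the sequence is Cauchy and converges
    to that point. *)
Lemma coding_map_cvg t :
  coding_approx f t k point @[k --> \oo] --> coding_map f t.
Proof.
have [r rf] := ifs_scale.
have [x [_ clx]] :
    [set: A] `&` cluster (coding_approx f t k point @[k --> \oo]) !=set0.
  by apply: (ifs_compact ifs_f); exact: filterT.
suff cvgx : coding_approx f t k point @[k --> \oo] --> x.
  by rewrite /coding_map (cvg_lim (@metric_hausdorff _ _) cvgx).
apply/metricType_numDomainType.cvgrPdist_lt => e e0.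
have e20 : 0 < e / 2 by rewrite divr_gt0.
have [k rk] := scale_small rf e20.
have near_k m n: (k <= m)%N -> (k <= n)%N ->
    mdist (coding_approx f t m point) (coding_approx f t n point) < r k.
  move=> km kn; rewrite -(subnKC km) -(subnKC kn) !coding_approxD.
  exact: mdist_coding_approx.
have [] := clx [set y | exists2 n, (k <= n)%N & y = coding_approx f t n point]
  (ball x (e / 2)).
- by exists k => // n /= kn; exists n.
- exact: nbhsx_ballx.
move=> _ [[n kn ->]]; rewrite ballEmdist /= => xn.
exists k => // m /= km.
apply: (le_lt_trans (metric_triangle _ (coding_approx f t n point) _)).
by rewrite [e]splitr ltrD// (lt_trans (near_k _ _ kn km)).
Qed.

Lemma coding_map_cons t :
  coding_map f t = f (t 0%N) (coding_map f (t \o succn)).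
Proof.
have := @coding_map_cvg t.
rewrite -cvg_shiftS => /= H.
apply: (@cvg_unique _ (@metric_hausdorff _ A) _ _ _ _ H).
rewrite [X in X @ _](_ : _ =
    f (t 0%N) \o fun k => coding_approx f (t \o succn) k point).
  by apply: continuous_cvg; [exact: ifs_continuous|exact: coding_map_cvg].
by apply/funext => k; rewrite /coding_approx mkseq_cons.
Qed.

Lemma coding_map_cat t k :
  coding_map f t =
  coding_approx f t k (coding_map f (fun n => t (k + n)%N)).
Proof.
elim: k t => [|k IHk] t; first by congr coding_map; apply/funext.
by rewrite coding_map_cons /coding_approx mkseq_cons /= (IHk (t \o succn)).
Qed.

End coding.

(** * Uniqueness of lexicographic maxima *)

Lemma lex_gt_asym N (s t : nat -> 'I_N.+1) : lex_gt s t -> ~ lex_gt t s.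
Proof.
move=> [k [eqk ltk]] [m [eqm ltm]].
have [km|mk|km] := ltngtP k m.
- by move: ltk; rewrite eqm// ltnn.
- by move: ltm; rewrite eqk// ltnn.
- by move: ltk; rewrite km ltnNge (ltnW ltm).
Qed.

Lemma is_lex_max_unique N (S : set (nat -> 'I_N.+1)) s t :
  is_lex_max S s -> is_lex_max S t -> s = t.
Proof.
move=> [Ss maxs] [St maxt]; apply: contrapT => st.
by apply: (lex_gt_asym (maxs _ St _) (maxt _ Ss _)) => // /esym.
Qed.

(** * Itineraries, the top section and regular points *)

Section itinerary.
Context {R : realType} {A : pmetricType R} {N : nat} (f : 'I_N.+1 -> A -> A).
Implicit Types (x y : A) (i j : 'I_N.+1) (s t : nat -> 'I_N.+1).

(** Smaller indices are greater symbols, so the least index is the greedy choice that makes the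
    itinerary a lexicographic maximum. *)
Definition first_index x : 'I_N.+1 :=
  xget ord0 [set i | range (f i) x /\ forall j, range (f j) x -> (i <= j)%N].

Definition shift_map x : A := xget point [set y | f (first_index x) y = x].

Definition itinerary x k : 'I_N.+1 := first_index (iter k shift_map x).

Definition regular : set A :=
  [set x | forall k, ~ critical_set f (iter k shift_map x)].

Lemma itineraryS x : itinerary x \o succn = itinerary (shift_map x).
Proof. by apply/funext => k; rewrite /itinerary /= -iterSr. Qed.

Lemma regularE : ~` regular = \bigcup_k (iter k shift_map @^-1` critical_set f).
Proof.
apply/seteqP; split=> [x /existsNP[k /contrapT ck]|x [k _ ck]].
  by exists k.
by move/(_ k).
Qed.

Lemma not_critical i j x :
  ~ critical_set f x -> range (f i) x -> range (f j) x -> i = j.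
Proof.
move=> cx fi fj; apply: contrapT => /eqP ij; apply: cx.
by exists i => //; exists j => //=; rewrite eq_sym.
Qed.

Hypothesis ifs_f : is_ifs f.

Lemma first_indexP x : range (f (first_index x)) x /\
  forall j, range (f j) x -> (first_index x <= j)%N.
Proof.
have [i _ fix_] : (\bigcup_i range (f i)) x by rewrite -(ifs_attractor ifs_f).
rewrite /first_index; case: xgetP => [_ -> //|].
have Pi : `[< range (f i) x >] by apply/asboolP.
case: (@arg_minnP _ i (fun j => `[< range (f j) x >]) (fun j => j : nat) Pi).
move=> m /asboolP mx mmin /(_ m); case; split=> // j jx.
by apply: mmin; apply/asboolP.
Qed.

Lemma shift_mapK x : f (first_index x) (shift_map x) = x.
Proof.
rewrite /shift_map; case: xgetP => [y -> //|].
have [[y _ fy] _] := first_indexP x.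
by move/(_ y); rewrite /= fy.
Qed.

Lemma first_index_regular i x :
  ~ critical_set f (f i x) -> first_index (f i x) = i.
Proof.
move=> cx; apply: (not_critical cx); last by exists x.
by have [] := first_indexP (f i x).
Qed.

Lemma shift_map_regular i x : ~ critical_set f (f i x) -> shift_map (f i x) = x.
Proof.
move=> cx; apply: (@ifs_injective _ _ _ _ ifs_f i).
by have := shift_mapK (f i x); rewrite (first_index_regular cx).
Qed.

(** Off the critical set [x] lies in a single range; the other ranges are finitely many closed sets,
    so a whole neighbourhood of [x] misses them. *)
Lemma near_first_index x : ~ critical_set f x ->
  \forall y \near x, first_index y = first_index x.
Proof.
move=> cx; have [fx _] := first_indexP x.
have : \forall y \near x, forall j, j != first_index x -> ~ range (f j) y.
  apply: filter_forall => j; have [->|jx] := eqVneq j (first_index x).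
    by apply: nearW.
  have : open (~` range (f j)) by rewrite openC; exact: ifs_range_closed.
  rewrite openE => /(_ x) H; have {}H := H _.
  apply: filterS (H _) => // fjx; move/eqP: jx; apply.
  exact: not_critical cx fjx fx.
apply: filterS => y ny; apply: contrapT => /eqP /ny; apply.
by have [] := first_indexP y.
Qed.

(** Near [x] the first index is constant, so the shift map coincides there with the inverse of a
    single [f i], which is continuous on the range of [f i]. *)
Lemma shift_map_continuous x :
  ~ critical_set f x -> {for x, continuous shift_map}.
Proof.
move=> cx; pose i := first_index x.
have [_ [h fK hc]] := ifs_homeomorphism ifs_f i.
have near_h : \forall y \near x, range (f i) y /\ shift_map y = h y.
  apply: filterS (near_first_index cx) => y yx; have := shift_mapK y.
  by rewrite yx => fy; rewrite -[in h y]fy fK; split=> //; exists (shift_map y).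
have [fx hx] := nbhs_singleton near_h.
move=> V; rewrite hx => /((subspace_continuousP _ _).1 hc x fx) hV.
by apply: filterS2 near_h hV => y [fy e] /(_ fy) /=; rewrite e.
Qed.

Lemma iter_shift_map_continuous k x :
  regular x -> {for x, continuous (iter k shift_map)}.
Proof.
move=> rx; elim: k => [|k IHk]; first exact: cvg_id.
exact: continuous_comp IHk (shift_map_continuous (rx k)).
Qed.

Lemma near_itinerary k x : regular x ->
  \forall y \near x, itinerary y k = itinerary x k.
Proof.
move=> rx.
exact: (iter_shift_map_continuous (k := k) rx (near_first_index (rx k))).
Qed.

Lemma coding_approx_itinerary k x :
  coding_approx f (itinerary x) k (iter k shift_map x) = x.
Proof.
elim: k x => // k IHk x.
rewrite /coding_approx mkseq_cons iterSr itineraryS /= [foldr _ _ _]IHk.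
exact: shift_mapK.
Qed.

Lemma mkseq_itineraryS k x :
  mkseq (itinerary x) k.+1 = first_index x :: mkseq (itinerary (shift_map x)) k.
Proof.
by rewrite mkseq_cons itineraryS.
Qed.

(** [x] is the image of its [k]-th iterate under the first [k] maps of its itinerary, hence within
    [r k] of the [k]-th approximation. *)
Lemma coding_itinerary x : coding_map f (itinerary x) = x.
Proof.
have [r rf] := ifs_scale ifs_f.
apply: (coding_map_unique rf) => k.
rewrite -[X in mdist _ X](coding_approx_itinerary k x).
exact: mdist_coding_approx.
Qed.

Lemma coding_mapS t : t 0%N = first_index (coding_map f t) ->
  coding_map f (t \o succn) = shift_map (coding_map f t).
Proof.
move=> t0; apply: (@ifs_injective _ _ _ _ ifs_f (t 0%N)).
by rewrite -(coding_map_cons ifs_f) t0 shift_mapK.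
Qed.

(** As long as [t] follows the itinerary of its point, [shift_map] acts on the point as the left
    shift acts on [t]. *)
Lemma iter_shift_map_coding k t :
  (forall m, (m < k)%N -> t m = itinerary (coding_map f t) m) ->
  iter k shift_map (coding_map f t) = coding_map f (fun n => t (k + n)%N).
Proof.
elim: k t => // k IHk t tk.
rewrite iterSr -coding_mapS; last exact: tk.
rewrite IHk// => m mk; rewrite coding_mapS; last exact: tk.
by rewrite -itineraryS; exact: tk.
Qed.

(** Up to the first index [k] where another address [t] departs, both follow the same orbit. The
    [k]-th iterate then lies in the range of [f (t k)], so the least admissible index is at most
    [t k]. *)
Lemma itinerary_lex_max x :
  is_lex_max (coding_map f @^-1` [set x]) (itinerary x).
Proof.
split=> [|t tx tnx]; first exact: coding_itinerary.
have ex : exists k, t k != itinerary x k.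
  apply: contrapT => nt; apply: tnx; apply/funext => k; apply: contrapT => tk.
  by apply: nt; exists k; apply/eqP.
case: (ex_minnP ex) => k tk kmin.
have tj m : (m < k)%N -> t m = itinerary x m.
  by move=> mk; apply/eqP; apply: contraTT mk => /kmin; rewrite -leqNgt.
exists k; split=> [m /tj //|].
rewrite ltn_neqAle eq_sym tk /=.
have [_] := first_indexP (iter k shift_map x); apply.
move: tx tj => /= <- tj; rewrite iter_shift_map_coding//.
by rewrite (coding_map_cons ifs_f) /= addn0; eexists.
Qed.

Lemma top_sectionE x : top_section f x = itinerary x.
Proof.
rewrite /top_section; apply: xget_unique; first exact: itinerary_lex_max.
by move=> s /is_lex_max_unique; apply; exact: itinerary_lex_max.
Qed.

(** Strong induction: once [t] agrees with the itinerary below [k], the [k]-th iterate is coded by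
    the tail of [t], and being non-critical it admits no first index other than [t k]. *)
Lemma regular_address t : regular (coding_map f t) ->
  itinerary (coding_map f t) = t.
Proof.
move=> rt; apply/funext => k.
elim/ltn_ind: k => k IHk; rewrite /itinerary iter_shift_map_coding.
  have := rt k; rewrite iter_shift_map_coding; last by move=> m /IHk.
  by rewrite (coding_map_cons ifs_f) /= addn0 => /first_index_regular.
by move=> m /IHk.
Qed.

(** The union [E] is backward invariant by construction; the closure needs an argument. If [f i x]
    is critical, [x] is already in [E]. Otherwise the shift map is continuous at [f i x] and inverts
    [f i] nearby, so it carries points of [E] close to [f i x] to points of [E] close to [x]. *)
Lemma dynamical_boundary_backward i x :
  dynamical_boundary f (f i x) -> dynamical_boundary f x.
Proof.
pose E := \bigcup_(k in [set k | (1 <= k)%N])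
  iter k (ifs_preimage f) (critical_set f).
have EE j y : E (f j y) -> E y.
  by move=> [k /= k1 kE]; exists k.+1 => //; exists j.
have [|cx] := pselect (critical_set f (f i x)).
  by move=> cx _; apply: subset_closure; exists 1%N => //; exists i.
move=> Dx V Vx.
have nV : nbhs (f i x) (shift_map @^-1` V).
  by apply: (shift_map_continuous cx); rewrite (shift_map_regular cx).
have [y [Ey [Vy iy]]] := Dx _ (filterI nV (near_first_index cx)).
exists (shift_map y); split=> //; apply: (EE i).
rewrite /= (first_index_regular cx) in iy.
by rewrite -iy shift_mapK.
Qed.

Lemma critical_backward i x :
  critical_set f (f i x) -> dynamical_boundary f x.
Proof. by move=> cx; apply: subset_closure; exists 1%N => //; exists i. Qed.

End itinerary.

(** * Continuity, intertwining and inversion of fractal transformations *)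

Section fractal_transformation.
Context {R : realType} {A B : pmetricType R} {N : nat}.
Variables (f : 'I_N.+1 -> A -> A) (g : 'I_N.+1 -> B -> B).
Hypotheses (ifs_f : is_ifs f) (ifs_g : is_ifs g).
Let T := fractal_transformation f g.

Lemma fractal_transformationE x : T x = coding_map g (itinerary f x).
Proof. by rewrite /T /fractal_transformation /= top_sectionE. Qed.

Lemma fractal_transformation_prefix k x :
  exists y, T x = coding_approx g (itinerary f x) k y.
Proof.
by rewrite fractal_transformationE (coding_map_cat ifs_g _ k); eexists.
Qed.

(** Points near a regular [x] share its first [k] symbols, so their images lie in the same [k]-fold
    image under the maps of [g], of diameter at most [r k]. *)
Lemma fractal_transformation_continuous x :
  regular f x -> {for x, continuous T}.
Proof.
move=> rx; have [r rg] := ifs_scale ifs_g.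
apply/metricType_numDomainType.cvgrPdist_lt => e e0.
have [k rk] := scale_small rg e0.
have : \forall y \near x, forall j : 'I_k, itinerary f y j = itinerary f x j.
  by apply: filter_forall => j; exact: near_itinerary.
apply: filterS => y yx.
have [x' ->] := fractal_transformation_prefix k x.
have [y' ->] := fractal_transformation_prefix k y.
have -> : coding_approx g (itinerary f y) k y' =
    coding_approx g (itinerary f x) k y'.
  congr foldr; apply: (@eq_from_nth _ ord0); rewrite !size_mkseq// => j jk.
  by rewrite !nth_mkseq//; exact: (yx (Ordinal jk)).
exact: lt_trans (mdist_coding_approx rg _ _ _ _) rk.
Qed.

Lemma fractal_transformation_cons i x :
  ~ critical_set f (f i x) -> T (f i x) = g i (T x).
Proof.
move=> cx; rewrite !fractal_transformationE (coding_map_cons ifs_g).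
rewrite itineraryS (shift_map_regular ifs_f cx).
by rewrite [itinerary _ _ _](first_index_regular ifs_f cx).
Qed.

(** The itinerary of [x] is an address of [T x]. When [T x] is regular it is the only one, so the
    top section of [g] returns it and the coding map of [f] decodes it to [x]. *)
Lemma fractal_transformationK x : regular g (T x) ->
  fractal_transformation g f (T x) = x.
Proof.
rewrite /fractal_transformation /= (top_sectionE ifs_g) fractal_transformationE.
by move=> /(regular_address ifs_g) ->; exact: coding_itinerary.
Qed.

End fractal_transformation.

(** * Borel sets of metric spaces *)

Section borel_sets.
Context {R : realType}.
Implicit Types A B : pmetricType R.

Lemma borel_open A (U : set A) : open U -> measurable (U : set (borel A)).
Proof. exact: sub_sigma_algebra. Qed.

Lemma borel_closed A (K : set A) : closed K -> measurable (K : set (borel A)).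
Proof.
move=> cK; rewrite -[K]setCK; apply: measurableC; apply: borel_open.
by rewrite openC.
Qed.

Lemma borel_fin_bigcup A (I : finType) (D : set I) (F : I -> set (borel A)) :
  (forall i, D i -> measurable (F i)) ->
  measurable (\bigcup_(i in D) F i : set (borel A)).
Proof.
by move=> mF; apply: fin_bigcup_measurable => //; exact: finite_finset.
Qed.

Lemma metric_ball_open A (x : A) e : open (ball x e).
Proof.
rewrite openE => y; rewrite ballEmdist /= => xy.
apply/nbhs_ballP; exists (e - mdist x y); rewrite /= ?subr_gt0// => z.
rewrite !ballEmdist /= ltrBrDl; exact: le_lt_trans (metric_triangle _ _ _).
Qed.

Lemma borel_measurable_fun A B (h : A -> B) :
  (forall U, open U -> measurable (h @^-1` U : set (borel A))) ->
  measurable_fun [set: borel A] (h : borel A -> borel B).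
Proof.
move=> hU; apply: (@measurability _ _ (borel A) (borel B) setT h open) => //.
by move=> _ [U oU <-]; rewrite setTI; exact: hU.
Qed.

Lemma borel_preimage A B (h : A -> B) (X : set (borel B)) :
  measurable_fun [set: borel A] (h : borel A -> borel B) ->
  measurable X -> measurable (h @^-1` X : set (borel A)).
Proof. by move=> mh mX; rewrite -[X in measurable X]setTI; exact: mh. Qed.

Lemma continuous_borel_measurable A B (h : A -> B) : continuous h ->
  measurable_fun [set: borel A] (h : borel A -> borel B).
Proof.
move=> ch; apply: borel_measurable_fun => U oU; apply: borel_open.
by apply: open_comp => // x _; exact: ch.
Qed.

End borel_sets.

(** * Sets that agree outside a null set *)

Section almost_everywhere.
Context {d : measure_display} {T : measurableType d} {R : realType}.
Variable mu : {measure set T -> \bar R}.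

Lemma measure_agree (Z X Y : set T) :
  measurable Z -> mu Z = 0%E -> measurable X -> measurable Y ->
  (forall x, ~ Z x -> X x <-> Y x) -> mu X = mu Y.
Proof.
move=> mZ Z0 mX mY XY.
have E : X `|` Z = Y `|` Z.
  by apply/seteqP; split=> x []; try (by right);
    have [Zx|/XY xy] := pselect (Z x); try (by right); move=> /xy; left.
by rewrite -(measureU0 mX mZ Z0) E measureU0.
Qed.

Lemma completion_agree (Z X S : set T) :
  measurable Z -> mu Z = 0%E -> measurable X ->
  (forall x, ~ Z x -> S x <-> X x) ->
  completed_algebra_gen mu S /\ completion mu S = mu X.
Proof.
move=> mZ Z0 mX SX.
have nSZ : mu.-negligible (S `&` Z) by exists Z; split=> // x [].
have mXZ : measurable (X `\` Z) by exact: measurableD.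
have SE : (X `\` Z) `|` (S `&` Z) = S.
  apply/seteqP; split=> [x [[Xx /SX H]|[]//]|x Sx]; first exact/H.
  have [Zx|nZx] := pselect (Z x); first by right.
  by left; split=> //; exact/SX.
split; first by exists (X `\` Z) => //; exists (S `&` Z).
rewrite -[in LHS]SE completionE//.
by apply: (measure_agree mZ Z0) => // x nZx; split=> [[]|].
Qed.

End almost_everywhere.

(** * Borel measurability of itineraries and fractal transformations *)

Section borel_itinerary.
Context {R : realType} {A : pmetricType R} {N : nat} (f : 'I_N.+1 -> A -> A).
Hypothesis ifs_f : is_ifs f.

Lemma critical_set_measurable : measurable (critical_set f : set (borel A)).
Proof.
apply: borel_fin_bigcup => i _; apply: borel_fin_bigcup => j _.
by apply: measurableI; apply: borel_closed; exact: ifs_range_closed.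
Qed.

Lemma ifs_preimage_measurable i (X : set (borel A)) :
  measurable X -> measurable (f i @^-1` X : set (borel A)).
Proof.
apply: borel_preimage; apply: continuous_borel_measurable.
exact: ifs_continuous.
Qed.

Lemma first_index_measurable i :
  measurable ([set x | first_index f x = i] : set (borel A)).
Proof.
rewrite (_ : [set _ | _] =
    range (f i) `\` \bigcup_(j in [set j : 'I_N.+1 | (j < i)%N]) range (f j)).
  apply: measurableD; first by apply: borel_closed; exact: ifs_range_closed.
  apply: borel_fin_bigcup => j _.
  by apply: borel_closed; exact: ifs_range_closed.
apply/seteqP; split=> x.
  move=> /= <-; have [fx xmin] := first_indexP ifs_f x.
  split=> // -[j /= ji fj].
  by have := xmin _ fj; rewrite leqNgt ji.
move=> [fi nfj]; have [fx xmin] := first_indexP ifs_f x.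
have := xmin _ fi; rewrite leq_eqVlt => /orP[/eqP/val_inj//|lt].
by case: nfj; exists (first_index f x).
Qed.

Lemma shift_map_measurable :
  measurable_fun [set: borel A] (shift_map f : borel A -> borel A).
Proof.
(* Complements are taken because compactness makes the [f i] closed maps, whereas images of open
   sets need not be open. *)
apply: borel_measurable_fun => U oU; rewrite -[U]setCK -preimage_setC.
apply: measurableC.
have cU : closed (~` U) by rewrite closedC.
rewrite (_ : _ @^-1` _ =
    \bigcup_i ([set x | first_index f x = i] `&` f i @` (~` U))).
  apply: borel_fin_bigcup => i _; apply: measurableI.
    exact: first_index_measurable.
  by apply: borel_closed; exact: ifs_image_closed.
apply/seteqP; split=> [x Ux|x [i _ [/= xi [y Uy yx]]]].
  exists (first_index f x) => //; split=> //.
  by exists (shift_map f x); [|exact: shift_mapK].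
suff -> : shift_map f x = y by [].
by apply: (ifs_injective ifs_f (i := i)); rewrite -[in LHS]xi shift_mapK.
Qed.

Lemma iter_shift_map_measurable k (X : set (borel A)) : measurable X ->
  measurable (iter k (shift_map f) @^-1` X : set (borel A)).
Proof.
elim: k X => // k IHk X mX.
exact: (IHk (shift_map f @^-1` X) (borel_preimage shift_map_measurable mX)).
Qed.

Lemma regularC_measurable : measurable (~` regular f : set (borel A)).
Proof.
rewrite regularE; apply: bigcupT_measurable => k.
apply: iter_shift_map_measurable => //; exact: critical_set_measurable.
Qed.

(** [P] is arbitrary so that the induction can fix the first symbol [i] and continue with the words
    [w] such that [P (i :: w)]. *)
Lemma mkseq_itinerary_measurable k (P : set (seq 'I_N.+1)) :
  measurable ([set x | P (mkseq (itinerary f x) k)] : set (borel A)).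
Proof.
elim: k P => [|k IHk] P.
  rewrite /mkseq /=; have [Pn|nP] := pselect (P [::]).
    by rewrite (_ : [set _ | _] = setT) //; apply/seteqP; split.
  by rewrite (_ : [set _ | _] = set0) //; apply/seteqP; split.
rewrite (_ : [set _ | _] = \bigcup_i ([set x | first_index f x = i] `&`
    shift_map f @^-1` [set y | P (i :: mkseq (itinerary f y) k)])).
  apply: borel_fin_bigcup => i _; apply: measurableI.
    exact: first_index_measurable.
  exact: borel_preimage shift_map_measurable (IHk [set w | P (i :: w)]).
apply/seteqP; split=> [x|x [i _ [/= <-]]]; rewrite /= mkseq_itineraryS//.
by move=> Px; exists (first_index f x).
Qed.

End borel_itinerary.

Lemma fractal_transformation_measurable {R : realType} {A B : pmetricType R}
    {N : nat} (f : 'I_N.+1 -> A -> A) (g : 'I_N.+1 -> B -> B) :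
  is_ifs f -> is_ifs g ->
  measurable_fun [set: borel A]
    (fractal_transformation f g : borel A -> borel B).
Proof.
move=> ifs_f ifs_g; apply: borel_measurable_fun => U oU.
have [r rg] := ifs_scale ifs_g.
(* T x lies in U iff some prefix of its address maps the whole space into U. *)
rewrite (_ : _ @^-1` _ = \bigcup_k [set x |
    [set w | forall y, U (foldr g y w)] (mkseq (itinerary f x) k)]).
  by apply: bigcupT_measurable => k; exact: mkseq_itinerary_measurable.
apply/seteqP; split=> [x Ux|x [k _ /= Uw]]; last first.
  by have [y ->] := fractal_transformation_prefix ifs_f ifs_g k x; exact: Uw.
have /nbhs_ballP[e /= e0 eU] : nbhs (fractal_transformation f g x) U.
  exact: open_nbhs_nbhs.
have [k rk] := scale_small rg e0.
exists k => // y; apply: eU; rewrite ballEmdist /=.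
have [z ->] := fractal_transformation_prefix ifs_f ifs_g k x.
exact: lt_trans (mdist_coding_approx rg _ _ _ _) rk.
Qed.

(** * Uniqueness of the invariant measure *)

Section invariant_measure.
Context {R : realType} {A : pmetricType R} {N : nat} (f : 'I_N.+1 -> A -> A).
Variable p : 'I_N.+1 -> R.
Hypotheses (ifs_f : is_ifs f) (p_prob : probability_vector p).

(* The two invariance equations turn the claim at k + 1 into the claim at k for
   the preimages of X and Y under the f_i, weighted by p. *)
Lemma invariant_measure_le_thickening (mu nu : probability (borel A) R)
    (r : nat -> R) k (X Y : set (borel A)) :
  is_invariant_measure f p mu -> is_invariant_measure f p nu ->
  contraction_scale f r ->
  measurable X -> measurable Y ->
  (forall x y : A, X x -> mdist x y < r k -> Y y) -> (mu X <= nu Y)%E.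
Proof.
move=> imu inu rf; elim: k X Y => [|k IHk] X Y mX mY XY.
  have [->|/set0P[x Xx]] := eqVneq X set0; first by rewrite measure0.
  rewrite (_ : Y = setT) ?probability_setT ?probability_le1//.
  by apply/seteqP; split=> // y _; apply: XY Xx (scale_diam rf _ _).
rewrite imu// inu//; apply: lee_sum => i _.
apply: lee_wpmul2l; first by rewrite lee_fin ltW//; case: p_prob.
apply: IHk; [exact: ifs_preimage_measurable|exact: ifs_preimage_measurable|].
by move=> x y Xx xy; apply: XY Xx (scale_contract rf _ xy).
Qed.

(** [K] is the decreasing intersection of its open neighbourhoods [V n]. Each has [nu]-mass at least
    [mu K] by thickening, and continuity from above passes to the limit. *)
Lemma invariant_measure_le_closed (mu nu : probability (borel A) R)
    (K : set A) :
  is_invariant_measure f p mu -> is_invariant_measure f p nu ->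
  closed K -> (mu K <= nu K)%E.
Proof.
move=> imu inu cK; have [r rf] := ifs_scale ifs_f.
pose V n : set (borel A) := \bigcup_(x in K) ball x (n.+1%:R^-1 : R).
have mV n : measurable (V n).
  by apply: borel_open; apply: bigcup_open => x _; exact: metric_ball_open.
have KV : K = \bigcap_n V n.
  apply/seteqP; split=> [x Kx n _|x Vx]; first by exists x => //; exact: ballxx.
  rewrite [K](closure_id _).1// => W /nbhs_ballP[e /= e0 eW].
  have [n ne] : exists n, n.+1%:R^-1 < e :> R.
    have /cvgrPdist_lt/(_ e e0)[n _ /(_ n (leqnn n))] := @cvg_harmonic R.
    by rewrite /= sub0r normrN gtr0_norm//; exists n.
  have [y Ky xy] := Vx n I; exists y; split=> //; apply: eW.
  exact/ball_sym/(le_ball (ltW ne)).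
have Vcvg : (nu \o V) n @[n --> \oo] --> nu K.
  rewrite [in X in _ --> X]KV; apply: nonincreasing_cvg_mu => //.
  - exact: le_lt_trans (probability_le1 _ _) (ltry 1).
  - exact: bigcapT_measurable.
  - move=> m n mn; apply/subsetPset => y [x Kx xy]; exists x => //.
    by apply: le_ball xy; rewrite lef_pV2 ?posrE// ler_nat.
rewrite -(cvg_lim _ Vcvg)//; apply: lime_ge.
  by apply/cvg_ex; eexists; exact: Vcvg.
apply: nearW => n; have [k rk] : exists k, r k < n.+1%:R^-1 
  by apply: (scale_small rf); rewrite invr_gt0.
apply: (invariant_measure_le_thickening imu inu rf (k := k)) => //.
  exact: borel_closed.
by move=> x y Kx xy; exists x => //; rewrite ballEmdist; exact: lt_trans rk.
Qed.

(** The inequality on closed sets, used in both directions on complements, gives equality on open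
    sets, an intersection-stable family generating the Borel sets. *)
Lemma invariant_measure_unique (mu nu : probability (borel A) R) X :
  is_invariant_measure f p mu -> is_invariant_measure f p nu ->
  measurable X -> mu X = nu X.
Proof.
move=> imu inu mX.
apply: (@g_sigma_algebra_measure_unique _ _ (borel A) open _
  (fun=> setT)) => //.
- by move=> U oU; exact: borel_open.
- by move=> _; exact: openT.
- by apply/seteqP; split=> // x _; exists 0%N.
- exact: openI.
- move=> U oU; have mU := borel_open oU.
  have mC (m : probability (borel A) R) : m U = (1 - m (~` U))%E.
    by rewrite -[in LHS](setCK U) probability_setC//; exact: measurableC.
  change (mu U = nu U); rewrite (mC mu) (mC nu).
  congr (_ - _)%E; apply/eqP; rewrite eq_le.
  by apply/andP; split; apply: invariant_measure_le_closed => //;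
    rewrite closedC.
- by move=> _; rewrite /= probability_setT ltry.
Qed.

(** * Null sets of the invariant measure in the non-overlapping case *)

Section non_overlapping.
Variable mu : probability (borel A) R.
Hypotheses (inv_mu : is_invariant_measure f p mu) (nov : non_overlapping f).

(* mu X is the p-average of the mu (f i @^-1` X), none of which exceeds it. *)
Lemma invariant_measure_preimage_eq (X Y : set (borel A)) j :
  measurable X -> measurable Y -> mu X = mu Y ->
  (forall i, (mu (f i @^-1` X) <= mu Y)%E) -> mu (f j @^-1` X) = mu Y.
Proof.
move=> mX mY XY le.
have fin Z : measurable Z -> mu Z = (fine (mu Z))%:E.
  by move=> mZ; rewrite fineK// fin_num_measure.
have mf i : measurable (f i @^-1` X : set (borel A)).
  exact: ifs_preimage_measurable.
have [p0 p1] := p_prob.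
have le' i : fine (mu (f i @^-1` X)) <= fine (mu Y).
  by rewrite -lee_fin -!fin//; exact: le.
have : \sum_i p i * (fine (mu Y) - fine (mu (f i @^-1` X))) = 0.
  rewrite (eq_bigr _ (fun i _ => mulrBr _ _ _)) sumrB -mulr_suml p1 mul1r.
  apply/eqP; rewrite subr_eq0; apply/eqP/EFin_inj; rewrite -fin// -XY inv_mu//.
  by rewrite -sumEFin; apply: eq_bigr => i _; rewrite (fin _ (mf i)).
move/eqP; rewrite psumr_eq0; last first.
  by move=> i _; rewrite mulr_ge0 ?subr_ge0// ltW.
move/allP => /(_ j (mem_index_enum j)).
rewrite /= mulf_eq0 gt_eqF//= subr_eq0 => /eqP e.
by rewrite (fin _ mY) e -fin.
Qed.

(** [D] is pulled back along the itinerary of a point outside it. Each preimage stays inside [D] and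
    keeps its mass, yet finitely many steps lead to the empty set. *)
Lemma dynamical_boundary_null : mu (dynamical_boundary f) = 0%E.
Proof.
set D := dynamical_boundary f.
have cD : closed D by exact: closed_closure.
have mD : measurable (D : set (borel A)) by exact: borel_closed.
have [r rf] := ifs_scale ifs_f.
(* The preimage of X under the f_i whose range contains x has a larger hole; at
   k = 0 the hole is the whole space. *)
have hole k (X : set (borel A)) x : measurable X -> X `<=` D -> mu X = mu D ->
    (forall y : A, mdist x y < r k -> ~ X y) -> mu D = 0%E.
  elim: k X x => [|k IHk] X x mX XD XmuD xX.
    rewrite -XmuD (_ : X = set0) ?measure0//.
    by apply/seteqP; split=> // y; exact: xX (scale_diam rf _ _).
  have [[x' _ fx] _] := first_indexP ifs_f x.
  have sub i : f i @^-1` X `<=` D.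
    by move=> y /XD; exact: dynamical_boundary_backward.
  apply: (IHk (f (first_index f x) @^-1` X) x') => //.
  - exact: ifs_preimage_measurable.
  - apply: invariant_measure_preimage_eq => // i.
    by apply: le_measure; rewrite ?inE//; exact: ifs_preimage_measurable.
  - move=> y xy; apply: xX; rewrite -{1}fx.
    exact: (scale_contract rf _ xy).
have [x nDx] : exists x, ~ D x.
  apply: contrapT => nD; apply: nov; apply/seteqP; split=> // x _.
  by apply: contrapT => nDx; apply: nD; exists x.
have /nbhs_ballP[e /= e0 eD] : nbhs x (~` D).
  by apply: open_nbhs_nbhs; split=> //; rewrite openC.
have [k rk] := scale_small rf e0.
apply: (hole k D x) => // y xy; apply: eD; rewrite ballEmdist /=.
exact: lt_trans rk.
Qed.

(** The union defining the dynamical boundary starts at [k = 1], so preimages of the critical set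
    are treated first; the set itself then follows from the invariance equation. *)
Lemma critical_preimage_null i : mu (f i @^-1` critical_set f) = 0%E.
Proof.
apply/eqP; rewrite -measure_le0 -dynamical_boundary_null.
apply: le_measure; rewrite ?inE.
- by apply: ifs_preimage_measurable => //; exact: critical_set_measurable.
- by apply: borel_closed; exact: closed_closure.
- by move=> x; exact: critical_backward.
Qed.

Lemma critical_set_null : mu (critical_set f) = 0%E.
Proof.
rewrite inv_mu; last exact: critical_set_measurable.
by rewrite big1// => i _; rewrite critical_preimage_null mule0.
Qed.

(** A form of the invariance equation for maps that are controlled only off the critical set, as the
    shift map and the fractal transformations are. *)
Lemma invariant_measure_agree (X : set (borel A))
    (Y : 'I_N.+1 -> set (borel A)) :
  measurable X -> (forall i, measurable (Y i)) ->
  (forall i x, ~ critical_set f (f i x) -> X (f i x) <-> Y i x) ->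
  mu X = (\sum_i (p i)%:E * mu (Y i))%E.
Proof.
move=> mX mY XY; rewrite inv_mu//; apply: eq_bigr => i _; congr (_ * _)%E.
apply: (measure_agree _ (critical_preimage_null i)) => //.
- by apply: ifs_preimage_measurable => //; exact: critical_set_measurable.
- exact: ifs_preimage_measurable.
- by move=> x; exact: XY.
Qed.

Lemma shift_map_invariant (X : set (borel A)) :
  measurable X -> mu (shift_map f @^-1` X) = mu X.
Proof.
move=> mX; rewrite (@invariant_measure_agree _ (fun=> X))//.
- rewrite -ge0_sume_distrl; last first.
    by move=> i _; rewrite lee_fin ltW//; case: p_prob.
  by rewrite sumEFin; case: p_prob => _ ->; rewrite mul1e.
- exact: borel_preimage (shift_map_measurable ifs_f) mX.
- by move=> i x cx; rewrite /= shift_map_regular.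
Qed.

Lemma regularC_null : mu (~` regular f) = 0%E.
Proof.
have critical_null k : mu (iter k (shift_map f) @^-1` critical_set f) = 0%E.
  elim: k => [|k IHk]; first exact: critical_set_null.
  have mk := iter_shift_map_measurable ifs_f k (critical_set_measurable ifs_f).
  rewrite -[RHS]IHk -[RHS](shift_map_invariant mk); congr (mu _).
  by apply/funext => x; rewrite /preimage /= -iterSr.
apply/(negligibleP mu (regularC_measurable ifs_f)); rewrite regularE.
apply: negligible_bigcup => k; apply/negligibleP; last exact: critical_null.
by apply: iter_shift_map_measurable => //; exact: critical_set_measurable.
Qed.

End non_overlapping.
End invariant_measure.

(** * Transport of the invariant measures *)

Section transport.
Context {R : realType} {A B : pmetricType R} {N : nat}.
Variables (f : 'I_N.+1 -> A -> A) (g : 'I_N.+1 -> B -> B) (p : 'I_N.+1 -> R).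
Variables (mu : probability (borel A) R) (nu : probability (borel B) R).
Hypotheses (ifs_f : is_ifs f) (ifs_g : is_ifs g).
Hypotheses (nov_f : non_overlapping f) (nov_g : non_overlapping g).
Hypotheses (p_prob : probability_vector p).
Hypotheses (inv_mu : is_invariant_measure f p mu).
Hypotheses (inv_nu : is_invariant_measure g p nu).

(** The intertwining relation off the critical set makes the distribution of [T] under [mu]
    invariant for [g]; uniqueness identifies it with [nu]. *)
Lemma fractal_transformation_pushforward (X : set (borel B)) : measurable X ->
  mu (fractal_transformation f g @^-1` X) = nu X.
Proof.
move=> mX; have mT := fractal_transformation_measurable ifs_f ifs_g.
pose T : {mfun borel A >-> borel B} := mfun_Sub (mem_set mT).
apply: (invariant_measure_unique ifs_g p_prob
  (mu := distribution mu T) _ inv_nu) => //.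
move=> Y mY; apply: (invariant_measure_agree ifs_f p_prob inv_mu nov_f).
- exact: borel_preimage.
- by move=> i; apply: borel_preimage => //; exact: ifs_preimage_measurable.
- by move=> i x cx; rewrite /= fractal_transformation_cons.
Qed.

Lemma fractal_transformation_image (X : set (borel B)) : measurable X ->
  completed_algebra_gen mu (fractal_transformation g f @` X) /\
  completion mu (fractal_transformation g f @` X) = nu X.
Proof.
move=> mX; rewrite -(fractal_transformation_pushforward mX).
have mT := fractal_transformation_measurable ifs_f ifs_g.
(* Outside [Z] both compositions can be undone: regularity of [x] for [f] gives one inclusion,
   regularity of its image for [g] the other. The second part of [Z] is null by the pushforward
   identity. *)
pose Z := ~` regular f `|` fractal_transformation f g @^-1` (~` regular g).
have m1 := regularC_measurable ifs_f.
have m2 := borel_preimage mT (regularC_measurable ifs_g).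
have n1 : mu (~` regular f) = 0%E by exact: (regularC_null ifs_f p_prob).
have n2 : mu (fractal_transformation f g @^-1` (~` regular g)) = 0%E.
  rewrite fractal_transformation_pushforward; last exact: regularC_measurable.
  exact: (regularC_null ifs_g p_prob).
apply: (@completion_agree _ _ _ mu Z).
- exact: measurableU.
- by rewrite measureU0.
- exact: borel_preimage.
move=> x /not_orP[/contrapT rx /contrapT rTx]; split.
  move=> [y Xy yx]; rewrite /= -yx fractal_transformationK//.
  by rewrite yx.
move=> XT; exists (fractal_transformation f g x) => //.
exact: fractal_transformationK.
Qed.

End transport.

Theorem theorem2p4 (R : realType) (N : nat) (A_F A_G : pmetricType R)
    (f : 'I_N.+1 -> A_F -> A_F) (g : 'I_N.+1 -> A_G -> A_G)
    (p : 'I_N.+1 -> R)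
    (mu_F : probability (borel A_F) R) (mu_G : probability (borel A_G) R) :
  is_ifs f -> is_ifs g ->
  non_overlapping f -> non_overlapping g ->
  probability_vector p ->
  is_invariant_measure f p mu_F -> is_invariant_measure g p mu_G ->
  let T_FG : A_F -> A_G := fractal_transformation f g in
  let T_GF : A_G -> A_F := fractal_transformation g f in
  [/\ measurable_fun [set: borel A_F] (T_FG : borel A_F -> borel A_G),
      {ae mu_F, forall x : A_F, {for x, continuous T_FG}},
      forall B : set (borel A_G), measurable B ->
        completed_algebra_gen mu_F (T_GF @` B) /\
        completion mu_F (T_GF @` B) = mu_G B &
      forall B : set (borel A_F), measurable B ->
        completed_algebra_gen mu_G (T_FG @` B) /\
        completion mu_G (T_FG @` B) = mu_F B].
Proof.
move=> ifs_f ifs_g nov_f nov_g p_prob inv_F inv_G T_FG T_GF; split.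
- exact: fractal_transformation_measurable.
- exists (~` regular f); split.
  + exact: regularC_measurable.
  + exact: (regularC_null ifs_f p_prob inv_F nov_f).
  + move=> x nc rx; apply: nc.
    exact: fractal_transformation_continuous.
- move=> B.
  exact: (fractal_transformation_image ifs_f ifs_g nov_f nov_g p_prob).
- move=> B.
  exact: (fractal_transformation_image ifs_g ifs_f nov_g nov_f p_prob).
Qed.
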